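(* Let $C(L)$ be the number of self-avoiding walks crossing the $L\times L$ square from one corner vertex to the opposite corner vertex, and let $\log\lambda=\lim_{L\to\infty}L^{-2}\log C(L)$. Then, as $L\to\infty$, $$C(L)=\lambda^{L^2+O(L)} .$$
   Context: For a positive integer $L$, the $L\times L$ square is the subgraph of the square lattice $\mathbb{Z}^2$ (nearest-neighbour edges) induced by the vertex set $\{0,1,\dots,L\}^2$. A self-avoiding walk is a nearest-neighbour lattice path that visits no vertex more than once. $C(L)$ counts the self-avoiding walks that stay in the $L\times L$ square, start at a fixed corner vertex (say $(0,0)$) and end at the opposite corner vertex (say $(L,L)$). It is known from earlier work that $\lim_{L\to\infty} L^{-2}\log C(L)$ exists and is finite; $\lambda$ is defined by setting this limit equal to $\log\lambda$. The notation $C(L)=\lambda^{L^2+O(L)}$ means $\log C(L)=(L^2+r(L))\log\lambda$ with $|r(L)|\le KL$ for some constant $K$ and all sufficiently large $L$. *)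

(* Defs.v *)
From HB Require Import structures.
From mathcomp Require Import all_boot all_order all_algebra.
From mathcomp Require Import all_classical all_reals all_analysis.

Set Implicit Arguments.
Unset Strict Implicit.
Unset Printing Implicit Defensive.

Import Order.TTheory GRing.Theory Num.Theory.

Definition lattice_adj : rel (int * int) :=
  fun u v => (`|u.1 - v.1| + `|u.2 - v.2| == 1)%N.

(* The vertex set {0, ..., L}^2 of the L x L square. *)
Definition square (L : nat) : finType := ('I_L.+1 * 'I_L.+1)%type.

Definition square_pos (L : nat) (u : square L) : int * int :=
  (Posz u.1, Posz u.2).

Definition square_adj (L : nat) : rel (square L) :=
  fun u v => lattice_adj (square_pos u) (square_pos v).

(* Walks are given by the sequence of all vertices they visit, the starting
   vertex included. *)
Definition crossing_saw (L : nat) (w : seq (square L)) : bool :=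
  if w is u :: p then
    [&& u == (ord0, ord0), path (@square_adj L) u p, uniq (u :: p)
      & last u p == (ord_max, ord_max)]
  else false.

Lemma size_crossing_saw (L : nat) (w : seq (square L)) :
  crossing_saw w -> size w <= #|square L|.
Proof.
case: w => [//|u p] /and4P[_ _ uniq_w _].
by rewrite -(card_uniqP uniq_w) max_card.
Qed.

(* By size_crossing_saw the length bound carried by the type of bounded
   sequences excludes no walk; it only makes the type finite. *)
Definition crossing_count (L : nat) : nat :=
  #|[set w : {bseq #|square L| of square L} | crossing_saw w]|.

(* Main.v *)
Require Import Defs.
From HB Require Import structures.
From mathcomp Require Import all_boot all_order all_algebra.
From mathcomp Require Import all_classical all_reals all_analysis.
From mathcomp Require Import zify ring lra.

(** Let C = crossing_count.

  Upper bound: nine crossings of a square, reflected alternately, can be chained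
  along a snake through a 3 x 3 array of squares, so C(3(L+1)-1) >= C(L)^9;
  iterating, log C(L) <= (L+1)^2 log lambda.

  Lower bound: cut a crossing of a large square into m x m blocks.  The crossing
  is determined by the edges it uses inside each block and by the edges between
  neighbouring blocks, and the latter cost only a factor exp(O(m)) per block.
  Inside a block it is a family of disjoint paths with ends on the boundary of
  the block, and every such family is the trace of a single crossing of the
  square with margin 3 around the block: a ladder of two rails runs around the
  block, and its inner rail is joined to the path ends in the order in which it
  passes them.  One strand runs along the outer rail.  When a path end is met,
  it becomes a second strand on the inner rail.  When the next path end is met,
  either it is joined to the inner strand, or the two strands are joined
  together and the new end takes over the outer rail; at least one of the two
  moves closes no cycle.  At the end there is one path.  Hence
  C(km-1) <= (C(m+5) exp(O(m)))^(k^2), and k -> oo gives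
  log C(m+5) >= (m-1)^2 log lambda - O(m). *)

Set Implicit Arguments.
Unset Strict Implicit.
Unset Printing Implicit Defensive.

(** * The undirected edges of a walk *)

Section Edges.
Variable W : eqType.
Implicit Types (p q : seq W) (u v x y : W).

Definition link x y : rel W :=
  fun u v => (x == u) && (y == v) || (x == v) && (y == u).

(** Edges are recorded in both orientations, so that reversing a path leaves the relation
    unchanged. *)
Fixpoint edge p : rel W := fun u v =>
  if p is x :: q then
    (if q is y :: _ then link x y u v else false) || edge q u v
  else false.
Arguments edge : simpl never.

Lemma edge_cons x y p u v :
  edge (x :: y :: p) u v = link x y u v || edge (y :: p) u v.
Proof. by []. Qed.

Lemma link_sym x y u v : link x y u v = link y x u v.
Proof. by rewrite /link orbC; congr (_ || _); rewrite andbC. Qed.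

Lemma edge_cat p x y q u v :
  edge (rcons p x ++ y :: q) u v =
  [|| edge (rcons p x) u v, link x y u v | edge (y :: q) u v].
Proof.
elim: p => [|z [|t p] IHp]; first by [].
  by rewrite /= in IHp; rewrite /= !(edge_cons z) IHp -!orbA.
by rewrite !rcons_cons !cat_cons !(edge_cons z) in IHp *; rewrite IHp -!orbA.
Qed.

Lemma edge_rcons p x y u v :
  edge (rcons (rcons p x) y) u v = edge (rcons p x) u v || link x y u v.
Proof. by rewrite -[rcons _ y]cats1 edge_cat [X in _ || (_ || X)]/edge !orbF. Qed.

Lemma edge_rev p u v : edge (rev p) u v = edge p u v.
Proof.
elim: p => [//|x [|y p] IHp]; first by [].
by rewrite edge_cons !rev_cons edge_rcons -rev_cons IHp link_sym orbC.
Qed.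

Lemma edge_mem p u v : edge p u v -> (u \in p) && (v \in p).
Proof.
elim: p => [//|x [//|y p] IHp]; rewrite edge_cons => /orP[|/IHp/andP[up vp]].
  by case/orP=> /andP[/eqP-> /eqP->]; rewrite !inE !eqxx ?orbT.
by rewrite !(in_cons x) up vp !orbT.
Qed.

Lemma edge_sym p u v : edge p u v = edge p v u.
Proof.
elim: p => [//|x [//|y p] IHp].
by rewrite !edge_cons IHp /link; congr (_ || _); rewrite orbC.
Qed.

Lemma edge_sorted (e : rel W) p u v :
  symmetric e -> sorted e p -> edge p u v -> e u v.
Proof.
move=> e_sym; elim: p => [//|x [//|y p] IHp] /= /andP[exy yp].
rewrite edge_cons => /orP[|/(IHp yp)//].
by case/orP=> /andP[/eqP<- /eqP<-] //; rewrite e_sym.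
Qed.

(** The start [x] of a simple path has at most one edge, which names the next vertex. Removing [x]
    leaves exactly the edges of the tail that avoid [x], so induction recovers the whole path. *)
Lemma edge_inj x p q :
  uniq (x :: p) -> uniq (x :: q) -> edge (x :: p) =2 edge (x :: q) -> p = q.
Proof.
have headE z y r : uniq (z :: y :: r) ->
    forall t, edge (z :: y :: r) z t = (t == y).
  move=> /andP[zyr _] t; rewrite edge_cons /link eqxx /=.
  have/negPf->: y != z by apply: contraNneq zyr => <-; rewrite mem_head.
  rewrite andbF orbF eq_sym; case: (t == y) => //=; apply: contraNF zyr.
  by move/edge_mem/andP=> [].
have tailE z y r : uniq (z :: y :: r) -> forall u v,
    edge (y :: r) u v = [&& u != z, v != z & edge (z :: y :: r) u v].
  move=> /andP[zyr _] u v; have [->|uz] := eqVneq u z.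
    by apply: contraNF zyr; move/edge_mem/andP=> [].
  have [->|vz] := eqVneq v z.
    by apply: contraNF zyr; move/edge_mem/andP=> [].
  by rewrite edge_cons /link ![z == _]eq_sym (negPf uz) (negPf vz).
elim: p x q => [|y p IHp] x [|z q] // xp xq eqE.
- by have:= eqE x z; rewrite (headE _ _ _ xq) eqxx.
- by have:= eqE x y; rewrite (headE _ _ _ xp) eqxx.
have yz : z == y by rewrite -(headE _ _ _ xp) eqE (headE _ _ _ xq).
rewrite (eqP yz) in xq eqE *; congr (_ :: _); apply: (IHp y).
- by case/andP: xp.
- by case/andP: xq.
by move=> u v; rewrite (tailE _ _ _ xp) (tailE _ _ _ xq) eqE.
Qed.

End Edges.
Arguments edge : simpl never.

Lemma edge_map (W W' : eqType) (f : W -> W') (p : seq W) (u v : W) :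
  injective f -> edge (map f p) (f u) (f v) = edge p u v.
Proof.
move=> f_inj; elim: p => [//|x [//|y p] IHp].
by rewrite /= !edge_cons -IHp /link !(inj_eq f_inj).
Qed.

(** * Families of disjoint paths and their joining along a ladder *)

Section LinearForests.
Variable W : eqType.
Variables (adj : rel W) (blk : pred W) (e0 : rel W).
Hypothesis adj_sym : symmetric adj.
Implicit Types (p q : seq W) (u v x y : W) (ps : seq (seq W)).

Fixpoint ends ps : seq W :=
  if ps is p :: qs then
    (if p is x :: q then [:: x; last x q] else [::]) ++ ends qs
  else [::].

Definition good p := (1 < size p) && sorted adj p.

Definition forest_edge ps : rel W := fun u v => has (fun p => edge p u v) ps.

(* E lists the end vertices, with multiplicity; F is a reserve of vertices that
   the paths do not visit. *)
Definition forest E F ps :=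
  [/\ all good ps, perm_eq (ends ps) E, uniq (flatten ps ++ F)
    & forall u v, blk u -> blk v -> forest_edge ps u v = e0 u v].

(** Forgets the paths: the walk along the ladder only needs to know which vertices are ends and
    which are still free. *)
Definition reaches E F := exists ps, forest E F ps.

Lemma good_rev p : good (rev p) = good p.
Proof.
rewrite /good size_rev rev_sorted; congr (_ && _).
by apply: eq_sorted => x y; rewrite adj_sym.
Qed.

(** Identifies lists that describe the same unordered family of undirected paths, so that any path
    can be moved to the front and reversed. *)
Definition reorder ps qs :=
  [/\ all good ps = all good qs, perm_eq (ends ps) (ends qs),
      perm_eq (flatten ps) (flatten qs) & forest_edge ps =2 forest_edge qs].

Lemma reorder_trans ps qs rs : reorder ps qs -> reorder qs rs -> reorder ps rs.
Proof.
move=> [g1 e1 f1 h1] [g2 e2 f2 h2]; split; first by rewrite g1.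
- exact: perm_trans e1 e2.
- exact: perm_trans f1 f2.
by move=> u v; rewrite h1.
Qed.

Lemma reorder_cons p ps qs : reorder ps qs -> reorder (p :: ps) (p :: qs).
Proof.
move=> [g1 e1 f1 h1]; split; rewrite /= ?g1 ?perm_cat2l //.
by move=> u v /=; rewrite h1.
Qed.

Lemma reorder_swap p q ps : reorder (p :: q :: ps) (q :: p :: ps).
Proof.
split=> /=; first by rewrite andbCA.
- exact/permPl/perm_catCA.
- exact/permPl/perm_catCA.
by move=> u v /=; rewrite orbCA.
Qed.

Lemma reorder_rev p ps : reorder (p :: ps) (rev p :: ps).
Proof.
split=> /=.
- by rewrite good_rev.
- rewrite perm_cat2r; case/lastP: p => [//|p x]; rewrite rev_rcons.
  case: p => [//|y p]; rewrite /= last_rcons rev_cons last_rcons.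
  by rewrite (perm_catC [:: y] [:: x]).
- by rewrite perm_cat2r perm_sym perm_rev.
by move=> u v /=; rewrite edge_rev.
Qed.

Lemma reorder_refl ps : reorder ps ps.
Proof. by split. Qed.

Lemma perm_swap x y p : perm_eq [:: x, y & p] [:: y, x & p].
Proof. exact/permPl/(perm_catCA [:: x] [:: y]). Qed.

Lemma mem_ends ps T : all good ps -> T \in ends ps ->
  exists p qs, reorder ps ((T :: p) :: qs).
Proof.
elim: ps => [//|[//|x p] ps IHps] /= /andP[_ gps]; rewrite !inE => /or3P[].
- by move/eqP->; exists p, ps; exact: reorder_refl.
- move/eqP->; case: (lastP p) => [|q y].
    by exists [::], ps; exact: reorder_refl.
  rewrite last_rcons; exists (rev (x :: q)), ps.
  by have:= reorder_rev (x :: rcons q y) ps; rewrite -rcons_cons rev_rcons.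
move=> /(IHps gps)[q [qs Hqs]]; exists q, ((x :: p) :: qs).
exact: reorder_trans (reorder_cons _ Hqs) (reorder_swap _ _ _).
Qed.

Lemma forest_reorder E F ps qs :
  reorder ps qs -> forest E F ps -> forest E F qs.
Proof.
move=> [g1 e1 f1 h1] [g e f h]; split; first by rewrite -g1.
- by apply: perm_trans e; rewrite perm_sym.
- by rewrite -(perm_uniq (perm_cat f1 (perm_refl F))).
by move=> u v bu bv; rewrite -h1 h.
Qed.

Lemma reaches_perm E E' F F' :
  perm_eq E E' -> perm_eq F F' -> reaches E F -> reaches E' F'.
Proof.
move=> EE' FF' [ps [g e f h]]; exists ps; split=> //.
- exact: perm_trans EE'.
- by rewrite -(perm_uniq (perm_cat (perm_refl (flatten ps)) FF')).
Qed.

Lemma reaches_drop E F G : reaches E (F ++ G) -> reaches E G.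
Proof.
move=> [ps [g e f h]]; exists ps; split=> //.
by apply: subseq_uniq f; rewrite cat_subseq // suffix_subseq.
Qed.

Lemma reaches_head T E F : reaches (T :: E) F ->
  exists p qs, forest (T :: E) F ((T :: p) :: qs).
Proof.
move=> [ps fps]; have [g e _ _] := fps.
have [] := @mem_ends ps T g; first by rewrite (perm_mem e) mem_head.
by move=> p [qs Hqs]; exists p, qs; apply: forest_reorder Hqs fps.
Qed.

(** Every new edge has an endpoint in [A], outside the block, so the edges inside the block are
    unchanged. The far end of the extended path is kept in the conclusion because [reaches_merge]
    must know which path it is dealing with. *)
Lemma forest_path T A E F p qs :
  path adj T A -> all (predC blk) A ->
  forest (T :: E) (A ++ F) ((T :: p) :: qs) ->
  exists2 q, last (last T A) q = last T p &
    forest (last T A :: E) F ((last T A :: q) :: qs).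
Proof.
elim: A T p => [|x A IHA] T p /=; first by exists p.
move=> /andP[Tx xA] /andP[bx bA] [/= /andP[gp gqs] e f h].
apply: (IHA _ (T :: p)) => //; split=> /=.
- by move: gp; rewrite gqs /good /= adj_sym Tx => /andP[_ ->].
- by move: e; rewrite /= !perm_cons.
- have {}f : uniq ((T :: p ++ flatten qs) ++ [:: x] ++ A ++ F) := f.
  by rewrite uniq_catCA in f.
move=> u v bu bv; rewrite -h //= edge_cons /link.
have/negPf->: x != u by apply: contraNneq bx => ->.
by have/negPf->: x != v by apply: contraNneq bx => ->.
Qed.

Lemma reaches_path T A E F :
  path adj T A -> all (predC blk) A -> reaches (T :: E) (A ++ F) ->
  reaches (last T A :: E) F.
Proof.
move=> TA bA /reaches_head[p [qs /(forest_path TA bA)[q _ fq]]].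
by exists ((last T A :: q) :: qs).
Qed.

(** The first path is reversed and followed by the second. [T] and [U] stop being ends, and the
    joining edge is not inside the block since [T] is outside. *)
Lemma forest_join T p U q qs E F :
  adj T U -> ~~ blk T -> perm_eq (last T p :: last U q :: ends qs) E ->
  forest (T :: last T p :: U :: last U q :: ends qs) F
    ((T :: p) :: (U :: q) :: qs) ->
  reaches E F.
Proof.
move=> TU bT eE [/= /and3P[gp gq gqs] e f h].
exists ((rcons (rev p) T ++ U :: q) :: qs); split=> /=.
- rewrite gqs andbT; move: gp gq; rewrite -[good (T :: p)]good_rev rev_cons.
  rewrite /good size_cat; case: (rev p) => [//|z r] /andP[_ /= gp] /andP[_ gq].
  by rewrite !addnS /= cat_path gp last_rcons /= TU.
- apply: perm_trans eE; rewrite -rev_cons.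
  case/lastP: p {gp e f h} => [//|p z]; rewrite last_rcons -rcons_cons rev_rcons.
  by rewrite /= last_cat.
- have {}f : uniq ((T :: p) ++ (U :: q ++ flatten qs) ++ F) by rewrite catA.
  rewrite -!catA -rev_cons /= (catA q) -cat_cons.
  have pT : perm_eq (rev (T :: p)) (T :: p) by rewrite perm_rev.
  by rewrite (perm_uniq (perm_cat pT (perm_refl _))).
move=> u v bu bv; rewrite -h //= edge_cat -rev_cons edge_rev.
rewrite /link; have/negPf->: T != u by apply: contraNneq bT => ->.
have/negPf->: T != v by apply: contraNneq bT => ->.
by rewrite /= orbA.
Qed.

Lemma last_out a A : ~~ blk a -> all (predC blk) A -> ~~ blk (last a A).
Proof. by elim: A a => [//|x A IHA] a _ /= /andP[]; apply: IHA. Qed.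

(** The choice that avoids cycles: [I] and [O] are the tips on the inner and outer rail, [v] is the
    path end just met. In the first outcome [I] is joined to [O] and [A] stays free; in the second
    [I] runs along [A] and is joined to [v]. *)
Lemma reaches_merge I O v A E F :
  path adj I A -> all (predC blk) A -> adj (last I A) v -> ~~ blk I ->
  adj I O -> reaches (I :: O :: v :: E) (A ++ F) ->
  reaches (v :: E) (A ++ F) \/ reaches (O :: E) F.
Proof.
move=> IA bA Av bI IO /reaches_head[p [qs fps]].
have [/= /andP[gp gqs] e _ _] := fps.
have {}e : perm_eq (last I p :: ends qs) (O :: v :: E).
  by move: e; rewrite perm_cons.
have [zv|zv] := eqVneq (last I p) v.
  (* Joining [I] to [v] would close a cycle here. But then [O] is an end of another path, and [I]
     can be joined to [O]. *)
  left; have eqs : perm_eq (ends qs) (O :: E).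
    rewrite -(perm_cons v) -{1}zv; exact: perm_trans e (perm_swap _ _ _).
  have [] := @mem_ends qs O gqs; first by rewrite (perm_mem eqs) mem_head.
  move=> q [rs Hrs]; have [_ e1 _ _] := Hrs.
  have f1 := forest_reorder (reorder_cons (I :: p) Hrs) fps.
  have e2 : perm_eq (last O q :: ends rs) E.
    rewrite -(perm_cons O); apply: perm_trans eqs; rewrite perm_sym.
    exact: e1.
  apply: (forest_join IO bI (p := p) (q := q) (qs := rs)); last first.
    by case: f1 => g1 _ f1 h1; split=> //=.
  by rewrite zv perm_cons.
(* Now [v] is an end of a path other than that of [I], so linking the two closes no cycle. *)
right.
have vqs : v \in ends qs.
  have: v \in last I p :: ends qs by rewrite (perm_mem e) !inE eqxx orbT.
  by rewrite inE eq_sym (negPf zv).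
have [q [rs Hrs]] := mem_ends gqs vqs; have [_ e1 _ _] := Hrs.
have := forest_reorder (reorder_cons (I :: p) Hrs) fps.
move=> /(forest_path IA bA)[r zr f1].
have bL := last_out bI bA.
apply: (forest_join Av bL (p := r) (q := q) (qs := rs)); last first.
  by case: f1 => g1 _ f1 h1; split=> //=.
rewrite zr -(perm_cons v); apply: perm_trans (_ : perm_eq _ (last I p :: ends qs)) _.
  by apply: perm_trans (perm_swap _ _ _) _; rewrite perm_cons perm_sym.
exact: perm_trans e (perm_swap _ _ _).
Qed.

Lemma reaches_two s T F : reaches [:: s; T] F ->
  exists p, [/\ good (s :: p), last s p = T, uniq (s :: p)
    & forall u v, blk u -> blk v -> edge (s :: p) u v = e0 u v].
Proof.
move=> /reaches_head[p [qs [/= /andP[gp gqs] e f h]]].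
have eqs : ends qs = [::].
  by apply: size0nil; move/perm_size: e => [].
case: qs eqs gqs e f h => [|[|x q] qs] //= _ _ e f h.
exists p; split=> //.
- have {}e : perm_eq [:: last s p] [:: T] by rewrite -(perm_cons s).
  by have:= perm_small_eq _ e => /(_ isT)[].
- have : uniq ((s :: p ++ [::]) ++ F) := f.
  by rewrite cats0 cat_uniq => /andP[].
by move=> u v bu bv; rewrite -h //= orbF.
Qed.

Lemma ends_even ps : all good ps -> ~~ odd (size (ends ps)).
Proof.
by elim: ps => [//|[//|x p] ps IHps] /= /andP[_ /IHps]; rewrite !negbK.
Qed.

Lemma reaches_even E F : reaches E F -> ~~ odd (size E).
Proof. by move=> [ps [/ends_even g /perm_size <-]]. Qed.

(* A column (z, A, B) of the ladder continues the inner rail along A and the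
   outer rail along B; z is the path end, if any, that the column picks up. *)
Definition column := (option W * seq W * seq W)%type.
Implicit Types (c : column) (cs : seq column).

(** [A] and [B] are nonempty, so every column supplies fresh tips; a rung joins these tips, and the
    path end is adjacent to the inner one. *)
Fixpoint ladder a b cs :=
  if cs is (z, A, B) :: ds then
    [&& path adj a A, all (predC blk) A, path adj b B, all (predC blk) B,
        0 < size A, 0 < size B, adj (last a A) (last b B),
        (if z is Some v then adj (last a A) v else true)
      & ladder (last a A) (last b B) ds]
  else true.

Definition column_end c := c.1.1.
Definition rails cs := flatten [seq c.1.2 ++ c.2 | c <- cs].
Definition outer_end b cs := foldl (fun x c => last x c.2) b cs.
Definition inner_end a cs := foldl (fun x c => last x c.1.2) a cs.

Lemma ladder_cat a b cs ds :
  ladder a b (cs ++ ds) =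
  ladder a b cs && ladder (inner_end a cs) (outer_end b cs) ds.
Proof.
elim: cs a b => [//|[[z A] B] cs IHcs] a b /=.
by rewrite IHcs !andbA.
Qed.

(** For a strand that enters a rail at the tip of a column: the tip is kept and the rest of the
    column's stretch of rail is given up. *)
Lemma reaches_last a A E F :
  0 < size A -> reaches E (A ++ F) -> reaches E (last a A :: F).
Proof.
case/lastP: A => [//|A x] _; rewrite last_rcons cat_rcons.
exact: reaches_drop.
Qed.

(* Between two columns either only the outer rail is in use (first case), or
   both rails are and their tips a and b are ends of the forest (second case). *)
Lemma reaches_ladder s a b cs E F :
  ladder a b cs -> adj a b -> ~~ blk a -> ~~ blk b ->
  E = [:: b] \/ E = [:: a; b] ->
  reaches (E ++ s :: pmap column_end cs) (rails cs ++ F) ->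
  reaches [:: outer_end b cs; s] F.
Proof.
elim: cs a b E => [|[[z A] B] cs IHcs] a b E /=.
  (* After the last column two active strands would leave three ends [a], [b], [s], which parity
     excludes. *)
  by move=> _ ab ba bb [->| -> /reaches_even].
case/and5P=> aA bA bB blB /and5P[A_gt0 B_gt0 ab' ov lad] ab ba bb.
have bA' := last_out ba bA; have bB' := last_out bb blB.
have step := IHcs _ _ _ lad ab' bA' bB'.
rewrite -catA -catA; case: z ov => [v|] ov [->| ->] /= rE.
(* One strand and a path end: the end steps onto the inner rail and becomes the second strand. *)
- apply: (step _ (or_intror erefl)).
  have {}rE := reaches_last a A_gt0 rE.
  have vbs : perm_eq (b :: s :: v :: pmap column_end cs)
    (v :: b :: s :: pmap column_end cs).
    exact/permPl/(perm_catCA [:: b; s] [:: v]).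
  have {}rE := reaches_perm vbs (perm_refl _) rE.
  have {}rE : reaches (last a A :: b :: s :: pmap column_end cs)
    (B ++ rails cs ++ F).
    by apply: (@reaches_path v [:: last a A]) rE; rewrite /= ?bA' // adj_sym ov.
  have {}rE := reaches_perm (perm_swap _ _ _) (perm_refl _) rE.
  have {}rE := reaches_path bB blB rE.
  exact: reaches_perm (perm_swap _ _ _) (perm_refl _) rE.
(* Two strands and a path end. If the two strands are joined, [v] crosses the free inner tip and the
   rung to the outer rail; otherwise [v] is absorbed and the outer strand goes on along [B]. *)
- apply: (step _ (or_introl erefl)).
  have vs : perm_eq (a :: b :: s :: v :: pmap column_end cs)
    (a :: b :: v :: s :: pmap column_end cs).
    by rewrite !perm_cons perm_swap.
  have {}rE := reaches_perm vs (perm_refl _) rE.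
  have [{}rE|] := reaches_merge aA bA ov ba ab rE; last exact: reaches_path.
  have {}rE := reaches_last a A_gt0 rE.
  have {}rE : reaches (last a A :: s :: pmap column_end cs)
    (B ++ rails cs ++ F).
    by apply: (@reaches_path v [:: last a A]) rE; rewrite /= ?bA' // adj_sym ov.
  have {}rE := reaches_last b B_gt0 rE.
  by apply: (@reaches_path _ [:: last b B]) rE; rewrite /= ?ab' ?bB'.
- apply: (step _ (or_introl erefl)).
  exact: reaches_path bB blB (reaches_drop rE).
- apply: (step _ (or_intror erefl)).
  have {}rE := reaches_path aA bA rE.
  have {}rE := reaches_perm (perm_swap _ _ _) (perm_refl _) rE.
  have {}rE := reaches_path bB blB rE.
  exact: reaches_perm (perm_swap _ _ _) (perm_refl _) rE.
Qed.

End LinearForests.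

(** * Cutting a walk into its runs inside a block *)

Section Runs.
Variable W : eqType.
Variables (blk : pred W) (e : rel W).
Implicit Types (p q w : seq W) (u v x y : W).

(* The first run listed is the one at the head of the walk; it is empty when the
   walk starts outside the block. *)
Fixpoint runs w : seq (seq W) :=
  if w is x :: w' then
    if blk x then (x :: head [::] (runs w')) :: behead (runs w')
    else [::] :: runs w'
  else [:: [::]].

Lemma runsE w : runs w = head [::] (runs w) :: behead (runs w).
Proof. by case: w => [//|x w] /=; case: ifP. Qed.

Lemma flatten_runs w : flatten (runs w) = [seq x <- w | blk x].
Proof.
elim: w => [//|x w IHw] /=; case: ifP => _ //=.
by rewrite -IHw [in RHS]runsE.
Qed.

Lemma head_runs x q w : head [::] (runs w) = x :: q -> blk x && (ohead w == Some x).
Proof. by case: w => [//|y w] /=; case: ifP => //= by_ [<- _]; rewrite by_ eqxx. Qed.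

Lemma sorted_runs w : sorted e w -> all (sorted e) (runs w).
Proof.
elim: w => [//|x w IHw] /= xw; have {}IHw := IHw (path_sorted xw).
case: ifP => _ //=; move: IHw; rewrite {1}runsE /= => /andP[hw ->].
rewrite andbT; case hE: (head _ _) hw => [//|y q] /= ->; rewrite andbT.
have /andP[_] := head_runs hE.
by case: w xw {hE} => [//|z w] /= /andP[xz _] /eqP[<-].
Qed.

Lemma edge_runs w u v :
  blk u -> blk v -> has (fun p => edge p u v) (runs w) = edge w u v.
Proof.
move=> bu bv; elim: w => [//|x w IHw] /=.
have out y : ~~ blk x || ~~ blk y -> link x y u v = false.
  rewrite /link => xy; apply/negbTE; apply: contraL xy.
  by case/orP=> /andP[/eqP-> /eqP->]; rewrite bu bv.
case: (boolP (blk x)) => bx /=; last first.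
  by rewrite IHw; case: w {IHw} => [//|y w]; rewrite edge_cons out ?bx.
move: IHw; rewrite {1}runsE /=.
case hE: (head _ _) => [|y q] /=; last first.
  have /andP[_] := head_runs hE; case: w hE => [//|z w] _ /eqP[->].
  by rewrite !edge_cons -orbA => <-.
case: w hE => [//|z w] /=; case: ifP => // bz _.
by rewrite edge_cons out // bz orbT.
Qed.

Definition ends_in (V : pred W) p :=
  if p is x :: q then V x && V (last x q) else true.

(** A run ends either where the walk itself starts or stops, or where the walk crosses the border of
    the block; each case has its hypothesis. *)
Lemma ends_runs (V : pred W) w :
  (forall x, ohead w = Some x -> blk x -> V x) ->
  (forall x q, w = rcons q x -> blk x -> V x) ->
  sorted (fun x y => (blk x != blk y) ==> (if blk x then V x else V y)) w ->
  all (ends_in V) (runs w).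
Proof.
move=> w_head w_last w_cut.
(* The head run may still grow to the left in the induction, so only its last vertex is
   constrained. *)
suff: all (ends_in V) (behead (runs w)) &&
      (if head [::] (runs w) is x :: q then V (last x q) else true).
  rewrite [in X in _ -> X]runsE /= => /andP[-> w_run]; rewrite andbT.
  case hE: (head _ _) w_run => [//|x q] /= ->; rewrite andbT.
  by have /andP[bx /eqP/w_head] := head_runs hE; apply.
elim: w w_last w_cut {w_head} => [//|x w IHw] w_last /= x_cut.
have w_last' y q : w = rcons q y -> blk y -> V y.
  by move=> wE; apply: (w_last y (x :: q)); rewrite wE.
have /andP[w_ends w_run] := IHw w_last' (path_sorted x_cut).
case: ifP => bx /=.
  rewrite w_ends; case hE: (head _ _) w_run => [|//] _ /=.
  case: w x_cut hE {IHw w_ends w_last'} w_last => [|y w] /=.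
    by move=> _ _ /(_ x [::] erefl bx).
  by move=> /andP[xy _]; move: xy; rewrite bx; case: (blk y).
rewrite andbT runsE /= w_ends andbT.
case hE: (head _ _) w_run => [//|y q] /= ->; rewrite andbT.
have /andP[by_] := head_runs hE.
case: w x_cut {hE IHw w_ends w_last' w_last} => [//|z w] /= /andP[xz _] /eqP[zy].
by move: xz; rewrite zy bx by_.
Qed.

Lemma mem_flatten_runs w p : p \in runs w -> all blk p.
Proof.
move=> pw; apply/allP=> x xp.
have: x \in flatten (runs w) by apply/flattenP; exists p.
by rewrite flatten_runs mem_filter => /andP[].
Qed.

End Runs.

(** * Turning the runs of a walk into one path by means of a ladder *)

Section LadderWalk.
Variable W : eqType.
Variables (adj : rel W) (blk : pred W).
Hypothesis adj_sym : symmetric adj.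
Implicit Types (p q w : seq W) (u v x y : W).

Lemma ends_sub (ps : seq (seq W)) : {subset ends ps <= flatten ps}.
Proof.
elim: ps => [//|[//|x p] ps IHps] y /=; rewrite !inE => /or3P[->//||/IHps].
  by move/eqP->; rewrite mem_cat orbA -in_cons mem_last.
by rewrite mem_cat => ->; rewrite !orbT.
Qed.

Lemma uniq_ends (ps : seq (seq W)) :
  all (fun p => 1 < size p) ps -> uniq (flatten ps) -> uniq (ends ps).
Proof.
elim: ps => [//|[//|x [//|y p]] ps IHps] /= gps.
rewrite -!cat_cons -[_ && _]/(uniq ((x :: y :: p) ++ flatten ps)) cat_uniq.
case/and3P=> /= /andP[xp _] dis /(IHps gps)->; rewrite andbT inE negb_or.
have lp : last y p \in y :: p by rewrite mem_last.
rewrite (contraNneq _ xp) => [/=| ->//].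
apply/andP; split; apply: contra dis => /ends_sub ps_mem; apply/hasP.
  by exists x; rewrite // inE eqxx.
by exists (last y p) => //; rewrite in_cons lp orbT.
Qed.

(** One fixed ladder offers every possible path end; only those used by the walk at hand are
    switched on. *)
Definition activate (X : seq W) (c : column W) : column W :=
  (if c.1.1 is Some v then if v \in X then Some v else None else None,
   c.1.2, c.2).

Lemma ladder_activate X a b cs :
  ladder adj blk a b cs -> ladder adj blk a b (map (activate X) cs).
Proof.
elim: cs a b => [//|[[z A] B] cs IHcs] a b /=.
case/and5P=> -> -> -> -> /and5P[-> -> -> ov /IHcs->]; rewrite andbT /=.
by case: z ov => [v|] //; case: ifP.
Qed.

Lemma pmap_activate X cs :
  pmap (@column_end W) (map (activate X) cs) =
  [seq v <- pmap (@column_end W) cs | v \in X].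
Proof.
elim: cs => [//|[[[v|] A] B] cs IHcs] //=.
by rewrite -IHcs /activate /=; case: ifP.
Qed.

Lemma rails_activate X cs : rails (map (activate X) cs) = rails cs.
Proof. by rewrite /rails -map_comp. Qed.

Lemma outer_end_activate X b cs :
  outer_end b (map (activate X) cs) = outer_end b cs.
Proof. by elim: cs b => [//|c cs IHcs] b /=. Qed.

(** The initial strand [s :: p] and the runs of [w] form a forest. Following the ladder reduces its
    ends to [s] and the outer tip, and [Z] then prolongs the single remaining path. *)
Lemma ladder_walk (e : rel W) w s p a b cs Z :
  (forall u v, blk u -> blk v -> e u v -> adj u v) ->
  sorted e w -> uniq w ->
  all (ends_in (mem (pmap (@column_end W) cs))) (runs blk w) ->
  uniq (pmap (@column_end W) cs) ->
  ladder adj blk a b cs -> adj a b -> ~~ blk a ->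
  0 < size p -> path adj s p -> last s p = b ->
  path adj (outer_end b cs) Z -> all (predC blk) Z ->
  uniq ((s :: p) ++ rails cs ++ Z) -> all (predC blk) ((s :: p) ++ rails cs) ->
  exists q, [/\ path adj s q, uniq (s :: q), last s q = last (outer_end b cs) Z,
      0 < size q
    & forall u v, blk u -> blk v -> edge (s :: q) u v = edge w u v].
Proof.
move=> e_adj w_e w_uniq w_ends V_uniq lad ab ba p_gt0 sp pb Zpath Zout F_uniq F_out.
set V := pmap _ cs in w_ends V_uniq.
(* Runs of at most one vertex carry no edge; dropping them leaves paths with two distinct ends. *)
pose ps := [seq r <- runs blk w | 1 < size r].
pose X := ends ps.
have psP r : r \in ps -> [/\ 1 < size r, all blk r, sorted e r & ends_in (mem V) r].
  rewrite mem_filter => /andP[r1 rw]; split=> //.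
  - exact: mem_flatten_runs rw.
  - by have /allP/(_ r rw) := sorted_runs blk w_e.
  - by have /allP/(_ r rw) := w_ends.
have sub_ps : subseq (flatten ps) ([seq x <- w | blk x]).
  rewrite -flatten_runs /ps; elim: (runs blk w) => [//|r rs IHr] /=.
  case: ifP => _ /=; first exact: cat_subseq.
  exact: subseq_trans IHr (suffix_subseq _ _).
have ps_uniq : uniq (flatten ps).
  by apply: subseq_uniq sub_ps _; apply: filter_uniq.
(* The ends of the runs, listed in the order in which the ladder meets them. *)
have XE : perm_eq X [seq v <- V | v \in X].
  apply: uniq_perm; [|exact: filter_uniq|].
    by apply: uniq_ends ps_uniq; apply/allP=> r /psP[].
  move=> x; rewrite mem_filter; case xX: (x \in X) => //=; symmetry.
  have {sub_ps ps_uniq w_ends}: forall rs,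
      all (ends_in (mem V)) rs -> {subset ends rs <= V}.
    elim=> [//|[//|y r] rs IHr] /= /andP[/andP[yV lV] rsV] z.
    by rewrite !inE => /or3P[/eqP->|/eqP->|/(IHr rsV)].
  by apply; last exact: xX; apply/allP=> r /psP[].
have := @reaches_ladder W adj blk (edge w) adj_sym s a b (map (activate X) cs) [:: b] Z.
move=> /(_ (ladder_activate X lad) ab ba) /=.
have bb : ~~ blk b.
  rewrite -pb; apply: last_out; move: F_out; rewrite /= all_cat => /andP[] //.
  by move=> _ /andP[].
move=> /(_ bb (or_introl erefl)).
rewrite pmap_activate rails_activate outer_end_activate -/V.
have start : reaches adj blk (edge w) [:: b, s & [seq v <- V | v \in X]]
    (rails cs ++ Z).
  exists ((s :: p) :: ps); split.
  - rewrite /= {1}/good /= sp andbT ltnS p_gt0 /=.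
    apply/allP=> r /psP[r1 br re _]; rewrite /good r1 /=.
    apply: (sub_in_sorted (P := blk)) re => // x y bx by_; exact: e_adj.
  - rewrite /= pb; apply: perm_trans (perm_swap _ _ _) _.
    by rewrite !perm_cons.
  - have -> : flatten ((s :: p) :: ps) ++ rails cs ++ Z =
        (s :: p) ++ flatten ps ++ rails cs ++ Z by rewrite /= -!catA.
    rewrite uniq_catCA cat_uniq ps_uniq F_uniq andbT andTb.
    apply/hasPn=> x; rewrite catA mem_cat => xF.
    have {xF}/= bx : predC blk x.
      by case/orP: xF => [/(allP F_out)|/(allP Zout)].
    apply: contra bx => /(mem_subseq sub_ps).
    by rewrite mem_filter => /andP[].
  move=> u v bu bv; rewrite -(@edge_runs W blk) // /forest_edge /=.
  have -> : edge (s :: p) u v = false.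
    apply/negP=> /edge_mem/andP[us _].
    have: predC blk u by apply: (allP F_out); rewrite mem_cat us.
    by rewrite /= bu.
  rewrite /ps has_filter -filter_predI -has_filter.
  apply: eq_has => r /=; case: r => [//|x [|y r]]; rewrite ?andbF ?andbT //=.
move=> /(_ start); rewrite -[Z]cats0 => rE.
have {}rE := reaches_path adj_sym Zpath Zout rE.
have {}rE := reaches_perm (perm_swap _ _ _) (perm_refl _) rE.
have [q [/andP[q_gt0 sq] lq q_uniq qE]] := reaches_two adj_sym rE.
by exists q; rewrite cats0.
Qed.

End LadderWalk.

(** * Lattice boxes and the straight sides of a ladder *)

Import Order.TTheory GRing.Theory Num.Theory.
Import numFieldNormedType.Exports.
Local Open Scope ring_scope.

Notation site := (int * int)%type.

Lemma lattice_adjC : symmetric lattice_adj.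
Proof. by move=> u v; rewrite /lattice_adj; congr (_ == _)%N; lia. Qed.

Definition box (a b : nat) (u : site) :=
  (0 <= u.1) && (u.1 < a%:Z) && ((0 <= u.2) && (u.2 < b%:Z)).

Definition box_adj (a b : nat) : rel site :=
  fun u v => [&& lattice_adj u v, box a b u & box a b v].

Lemma box_adjC a b : symmetric (box_adj a b).
Proof. by move=> u v; rewrite /box_adj lattice_adjC [box a b u && _]andbC. Qed.

Section Sides.
Variable W : eqType.
Variables (adj : rel W) (blk : pred W) (v a b : nat -> W).

(** The columns start at [k.+1], because [a k] and [b k] are the tips reached before the side
    begins. *)
Definition side k n : seq (column W) :=
  [seq (Some (v i), [:: a i], [:: b i]) | i <- iota k.+1 n].

Lemma inner_end_side k n x :
  x = a k -> inner_end x (side k n) = a (k + n)%N.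
Proof.
elim: n x k => [|n IHn] x k ->; first by rewrite addn0.
by rewrite -addSnnS -(IHn _ k.+1 erefl).
Qed.

Lemma outer_end_side k n y :
  y = b k -> outer_end y (side k n) = b (k + n)%N.
Proof.
elim: n y k => [|n IHn] y k ->; first by rewrite addn0.
by rewrite -addSnnS -(IHn _ k.+1 erefl).
Qed.

Lemma ladder_side k n x y :
  x = a k -> y = b k ->
  (forall i, (k < i <= k + n)%N ->
     [&& adj (a i.-1) (a i), adj (b i.-1) (b i), adj (a i) (b i), adj (a i) (v i),
        ~~ blk (a i) & ~~ blk (b i)]) ->
  ladder adj blk x y (side k n).
Proof.
elim: n k x y => [//|n IHn] k x y -> -> kP /=.
have /and5P[-> -> -> -> /andP[-> ->]] := kP k.+1 ltac:(lia).
by rewrite /=; apply: IHn => // i ik; apply: kP; lia.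
Qed.

Lemma pmap_side k n : pmap (@column_end W) (side k n) = map v (iota k.+1 n).
Proof. by rewrite /side; elim: (iota _ _) => [//|i s IHs] /=; rewrite -IHs. Qed.

Lemma rails_side (P : pred W) k n :
  (forall i, (k < i <= k + n)%N -> P (a i) && P (b i)) ->
  all P (rails (side k n)).
Proof.
move=> kP; apply/allP=> x /flatten_mapP[c /mapP[i]].
rewrite mem_iota => ik ->; rewrite !inE.
have /andP[Pa Pb] := kP i ltac:(lia).
by case/orP=> /eqP->.
Qed.

Lemma uniq_rails_side k n :
  injective a -> injective b -> (forall i j, a i != b j) ->
  uniq (rails (side k n)).
Proof.
move=> a_inj b_inj ab; rewrite /rails /side.
elim: n k => [//|n IHn] k /=; rewrite IHn inE (negPf (ab _ _)) andbT /=.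
apply/andP; split; apply/negP=> /flatten_mapP[c /mapP[i]];
  rewrite mem_iota => ik ->; rewrite !inE.
  by case/orP=> /eqP => [/a_inj|/eqP]; [lia|rewrite (negPf (ab _ _))].
by case/orP=> /eqP => [/esym/eqP|/b_inj]; [rewrite (negPf (ab _ _))|lia].
Qed.

End Sides.

(** * The concrete ladder around an m x m block *)

Section Moat.
Variable m : nat.
Hypothesis m_gt1 : (1 < m)%N.

(* In the square {0, ..., m + 5}^2 the inner rail runs at distance 2 from the
   boundary and the outer rail at distance 1; the boundary itself is used only to
   lead from the origin to the ladder and from its far end to the opposite
   corner. *)
Definition block (u : site) :=
  (3 <= u.1) && (u.1 < m%:Z + 3) && ((3 <= u.2) && (u.2 < m%:Z + 3)).

Notation adj := (box_adj (m + 6) (m + 6)).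

(** The sides are passed counterclockwise and have m, m - 1, m - 1 and m - 2 columns, so that each
    corner vertex of the block is offered exactly once. *)
Definition south : seq (column site) :=
  side (fun i => (i%:Z, 3)) (fun i => (i%:Z, 2)) (fun i => (i%:Z, 1)) 2 m.

Definition east : seq (column site) :=
  side (fun i => (m%:Z + 2, i%:Z)) (fun i => (m%:Z + 3, i%:Z))
       (fun i => (m%:Z + 4, i%:Z)) 3 m.-1.

Definition north : seq (column site) :=
  side (fun i => (m%:Z + 2 - i%:Z, m%:Z + 2)) (fun i => (m%:Z + 2 - i%:Z, m%:Z + 3))
       (fun i => (m%:Z + 2 - i%:Z, m%:Z + 4)) 0 m.-1.

Definition west : seq (column site) :=
  side (fun i => (3, m%:Z + 2 - i%:Z)) (fun i => (2, m%:Z + 2 - i%:Z))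
       (fun i => (1, m%:Z + 2 - i%:Z)) 0 m.-2.

Definition corner_se : column site :=
  (None, [:: (m%:Z + 3, 2); (m%:Z + 3, 3)],
   [:: (m%:Z + 3, 1); (m%:Z + 4, 1); (m%:Z + 4, 2); (m%:Z + 4, 3)]).

Definition corner_ne : column site :=
  (None, [:: (m%:Z + 3, m%:Z + 3); (m%:Z + 2, m%:Z + 3)],
   [:: (m%:Z + 4, m%:Z + 3); (m%:Z + 4, m%:Z + 4); (m%:Z + 3, m%:Z + 4);
       (m%:Z + 2, m%:Z + 4)]).

Definition corner_nw : column site :=
  (None, [:: (2, m%:Z + 3); (2, m%:Z + 2)],
   [:: (2, m%:Z + 4); (1, m%:Z + 4); (1, m%:Z + 3); (1, m%:Z + 2)]).

Definition moat : seq (column site) :=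
  south ++ corner_se :: east ++ corner_ne :: north ++ corner_nw :: west.

Definition entry : seq site := [:: (0, 0); (1, 0); (1, 1); (2, 1)].

Definition exit : seq site :=
  [seq (0, i%:Z) | i <- iota 4 (m + 2)] ++
  [seq (i%:Z, m%:Z + 5) | i <- iota 1 (m + 5)].

Lemma outer_end_moat : outer_end (2, 1) moat = (1, 4).
Proof.
rewrite /moat /outer_end !foldl_cat /= !foldl_cat /= foldl_cat /=.
by rewrite -/(outer_end _ _) (@outer_end_side _ _ _ _ 0) ?subr0 //; congr (_, _); lia.
Qed.

Lemma ladder_moat : ladder adj block (2, 2) (2, 1) moat.
Proof.
have ladder_south : ladder adj block (2, 2) (2, 1) south.
  apply: (ladder_side (k := 2)) => // i ik.
  by rewrite /box_adj /lattice_adj /box /block /=; lia.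
have ladder_east : ladder adj block (m%:Z + 3, 3) (m%:Z + 4, 3) east.
  apply: (ladder_side (k := 3)) => // i ik.
  by rewrite /box_adj /lattice_adj /box /block /=; lia.
have ladder_north : ladder adj block (m%:Z + 2, m%:Z + 3) (m%:Z + 2, m%:Z + 4) north.
  apply: (ladder_side (k := 0)) => [||i ik]; rewrite ?subr0 //.
  by rewrite /box_adj /lattice_adj /box /block /=; lia.
have ladder_west : ladder adj block (2, m%:Z + 2) (1, m%:Z + 2) west.
  apply: (ladder_side (k := 0)) => [||i ik]; rewrite ?subr0 //.
  by rewrite /box_adj /lattice_adj /box /block /=; lia.
rewrite /moat ladder_cat ladder_south.
rewrite (@inner_end_side _ _ _ _ 2) // (@outer_end_side _ _ _ _ 2) // /=.
rewrite ladder_cat ladder_east.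
rewrite (@inner_end_side _ _ _ _ 3) // (@outer_end_side _ _ _ _ 3) //=.
rewrite ladder_cat ladder_north.
rewrite (@inner_end_side _ _ _ _ 0) ?subr0 // (@outer_end_side _ _ _ _ 0) ?subr0 //=.
rewrite ladder_west /box_adj /lattice_adj /box /block /=.
by lia.
Qed.

Lemma exit_path : path adj (1, 4) exit.
Proof.
have up n k : (k + n <= m + 5)%N ->
    path adj (0, k%:Z) [seq (0, i%:Z) | i <- iota k.+1 n].
  elim: n k => [//|n IHn] k kn /=; rewrite IHn ?andbT; last by lia.
  by rewrite /box_adj /lattice_adj /box /=; lia.
have right n k : (k + n <= m + 5)%N ->
    path adj (k%:Z, m%:Z + 5) [seq (i%:Z, m%:Z + 5) | i <- iota k.+1 n].
  elim: n k => [//|n IHn] k kn /=; rewrite IHn ?andbT; last by lia.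
  by rewrite /box_adj /lattice_adj /box /=; lia.
have upE n : last (0, 4%:Z) [seq (0 : int, i%:Z) | i <- iota 5 n] = (0, (4 + n)%:Z).
  rewrite (last_map _ _ 4%N); congr (_, _).
  by elim: n 4%N => [|n IHn] k /=; [lia|rewrite IHn; lia].
have -> : exit = (0, 4%:Z) :: [seq (0, i%:Z) | i <- iota 5 (m + 1)] ++
    [seq (i%:Z, m%:Z + 5) | i <- iota 1 (m + 5)].
  by rewrite /exit addnS.
rewrite /= cat_path up ?upE; last by lia.
have -> : (0 : int, (4 + (m + 1))%:Z) = (0%:Z, m%:Z + 5) by congr (_, _); lia.
rewrite right // andbT.
by rewrite /box_adj /lattice_adj /box /=; lia.
Qed.

Lemma last_exit : last (1, 4) exit = (m%:Z + 5, m%:Z + 5).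
Proof.
rewrite last_cat (addnS m 4) /= (last_map (fun i : nat => (i%:Z, m%:Z + 5)) _ 1%N).
congr (_, _).
have -> : forall n k, last k (iota k.+1 n) = (k + n)%N.
  by elim=> [|n IHn] k /=; [lia|rewrite IHn; lia].
by lia.
Qed.

Definition within (P : pred site) (s : seq site) := uniq s && all P s.

Lemma within_cat (P Q : pred site) s t :
  within P s -> within Q t -> (forall u, P u -> ~~ Q u) ->
  within (predU P Q) (s ++ t).
Proof.
move=> /andP[us sP] /andP[ut tQ] PQ; rewrite /within cat_uniq us ut all_cat andbT /=.
apply/andP; split; first by apply/hasPn=> u /(allP tQ); apply: contraL => /(allP sP)/PQ.
by rewrite (sub_all _ sP) ?(sub_all _ tQ) // => u /= ->; rewrite ?orbT.
Qed.

Definition rect (x0 x1 y0 y1 : int) : pred site :=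
  fun u => (x0 <= u.1 <= x1) && (y0 <= u.2 <= y1).

Lemma within_side (P : pred site) v a b k n :
  injective a -> injective b -> (forall i j, a i != b j) ->
  (forall i, (k < i <= k + n)%N -> P (a i) && P (b i)) ->
  within P (rails (side v a b k n)).
Proof. by move=> a_inj b_inj ab kP; rewrite /within uniq_rails_side ?rails_side. Qed.

(** Each piece of the route gets a rectangle of its own. The rectangles are pairwise disjoint and
    avoid the block, which is linear arithmetic. *)
Lemma within_route : within (predC block) (entry ++ rails moat ++ exit).
Proof.
have h_west : within (rect 1 2 4 (m%:Z + 1)) (rails west).
  by apply: within_side => [i j []|i j []|i j|i ik]; rewrite ?xpair_eqE /rect /=; lia.
have h_north : within (rect 3 (m%:Z + 1) (m%:Z + 3) (m%:Z + 4)) (rails north).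
  by apply: within_side => [i j []|i j []|i j|i ik]; rewrite ?xpair_eqE /rect /=; lia.
have h_east : within (rect (m%:Z + 3) (m%:Z + 4) 4 (m%:Z + 2)) (rails east).
  by apply: within_side => [i j []|i j []|i j|i ik]; rewrite ?xpair_eqE /rect /=; lia.
have h_south : within (rect 3 (m%:Z + 2) 1 2) (rails south).
  by apply: within_side => [i j []|i j []|i j|i ik]; rewrite ?xpair_eqE /rect /=; lia.
have h_entry : within (rect 0 2 0 1) entry by [].
have h_se : within (rect (m%:Z + 3) (m%:Z + 4) 1 3) (corner_se.1.2 ++ corner_se.2).
  by rewrite /within /rect /= !inE !xpair_eqE; lia.
have h_ne : within (rect (m%:Z + 2) (m%:Z + 4) (m%:Z + 3) (m%:Z + 4))
    (corner_ne.1.2 ++ corner_ne.2).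
  by rewrite /within /rect /= !inE !xpair_eqE; lia.
have h_nw : within (rect 1 2 (m%:Z + 2) (m%:Z + 4)) (corner_nw.1.2 ++ corner_nw.2).
  by rewrite /within /rect /= !inE !xpair_eqE; lia.
have h_up : within (rect 0 0 4 (m%:Z + 5)) [seq (0, i%:Z) | i <- iota 4 (m + 2)].
  rewrite /within map_inj_uniq ?iota_uniq => [|i j [->]//].
  by apply/allP=> _ /mapP[i + ->]; rewrite mem_iota /rect /=; lia.
have h_right : within (rect 1 (m%:Z + 5) (m%:Z + 5) (m%:Z + 5))
    [seq (i%:Z, m%:Z + 5) | i <- iota 1 (m + 5)].
  rewrite /within map_inj_uniq ?iota_uniq => [|i j [->]//].
  by apply/allP=> _ /mapP[i + ->]; rewrite mem_iota /rect /=; lia.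
have h := within_cat h_up h_right
  ltac:(clear -m_gt1; by move=> u; rewrite /rect /=; lia).
have {}h := within_cat h_west h
  ltac:(clear -m_gt1; by move=> u; rewrite /rect /=; lia).
have {}h := within_cat h_nw h
  ltac:(clear -m_gt1; by move=> u; rewrite /rect /=; lia).
have {}h := within_cat h_north h
  ltac:(clear -m_gt1; by move=> u; rewrite /rect /=; lia).
have {}h := within_cat h_ne h
  ltac:(clear -m_gt1; by move=> u; rewrite /rect /=; lia).
have {}h := within_cat h_east h
  ltac:(clear -m_gt1; by move=> u; rewrite /rect /=; lia).
have {}h := within_cat h_se h
  ltac:(clear -m_gt1; by move=> u; rewrite /rect /=; lia).
have {}h := within_cat h_south h
  ltac:(clear -m_gt1; by move=> u; rewrite /rect /=; lia).
have {}h := within_cat h_entry h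
  ltac:(clear -m_gt1; by move=> u; rewrite /rect /=; lia).
move: h => /andP[h_uniq h_all].
have -> : entry ++ rails moat ++ exit = entry ++ rails south ++
    (corner_se.1.2 ++ corner_se.2) ++ rails east ++
    (corner_ne.1.2 ++ corner_ne.2) ++ rails north ++
    (corner_nw.1.2 ++ corner_nw.2) ++ rails west ++ exit.
  have rails_cat (cs ds : seq (column site)) :
      rails (cs ++ ds) = rails cs ++ rails ds.
    by rewrite /rails map_cat flatten_cat.
  have rails_cons c (ds : seq (column site)) :
      rails (c :: ds) = (c.1.2 ++ c.2) ++ rails ds by [].
  by rewrite /moat !(rails_cat, rails_cons) -!catA.
rewrite /within h_uniq andTb; apply: sub_all h_all => u.
clear -m_gt1; by rewrite /rect /block /=; lia.
Qed.

Definition moat_ends : seq site :=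
  [seq (i%:Z, 3) | i <- iota 3 m] ++ [seq (m%:Z + 2, i%:Z) | i <- iota 4 m.-1] ++
  [seq (m%:Z + 2 - i%:Z, m%:Z + 2) | i <- iota 1 m.-1] ++
  [seq (3, m%:Z + 2 - i%:Z) | i <- iota 1 m.-2].

Lemma pmap_moat : pmap (@column_end _) moat = moat_ends.
Proof.
rewrite /moat !pmap_cat pmap_side /= pmap_cat pmap_side /= pmap_cat /=.
by rewrite !pmap_side.
Qed.

Lemma uniq_moat_ends : uniq moat_ends.
Proof.
have h_south : within (rect 3 (m%:Z + 2) 3 3) [seq (i%:Z, 3) | i <- iota 3 m].
  rewrite /within map_inj_uniq ?iota_uniq => [|i j [->]//].
  by apply/allP=> _ /mapP[i + ->]; rewrite mem_iota /rect /=; lia.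
have h_east : within (rect (m%:Z + 2) (m%:Z + 2) 4 (m%:Z + 2))
    [seq (m%:Z + 2, i%:Z) | i <- iota 4 m.-1].
  rewrite /within map_inj_uniq ?iota_uniq => [|i j [->]//].
  by apply/allP=> _ /mapP[i + ->]; rewrite mem_iota /rect /=; lia.
have h_north : within (rect 3 (m%:Z + 1) (m%:Z + 2) (m%:Z + 2))
    [seq (m%:Z + 2 - i%:Z, m%:Z + 2) | i <- iota 1 m.-1].
  rewrite /within map_inj_uniq ?iota_uniq => [|i j []]; last by lia.
  by apply/allP=> _ /mapP[i + ->]; rewrite mem_iota /rect /=; lia.
have h_west : within (rect 3 3 4 (m%:Z + 1))
    [seq (3, m%:Z + 2 - i%:Z) | i <- iota 1 m.-2].
  rewrite /within map_inj_uniq ?iota_uniq => [|i j []]; last by lia.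
  by apply/allP=> _ /mapP[i + ->]; rewrite mem_iota /rect /=; lia.
have h := within_cat h_north h_west
  ltac:(clear -m_gt1; by move=> u; rewrite /rect /=; lia).
have {}h := within_cat h_east h
  ltac:(clear -m_gt1; by move=> u; rewrite /rect /=; lia).
have {}h := within_cat h_south h
  ltac:(clear -m_gt1; by move=> u; rewrite /rect /=; lia).
by case/andP: h.
Qed.

Lemma mem_ring_ends u :
  block u -> [|| u.1 == 3, u.1 == m%:Z + 2, u.2 == 3 | u.2 == m%:Z + 2] ->
  u \in moat_ends.
Proof.
case: u => x y; rewrite /block /= => bu bd; rewrite !mem_cat.
have [y3|y3] := eqVneq y 3.
  apply/orP; left; apply/mapP; exists (absz x); first by rewrite mem_iota; lia.
  by congr (_, _); lia.
have [xm|xm] := eqVneq x (m%:Z + 2).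
  apply/or4P/Or42/mapP; exists (absz y); first by rewrite mem_iota; lia.
  by congr (_, _); lia.
have [ym|ym] := eqVneq y (m%:Z + 2).
  apply/or4P/Or43/mapP; exists (absz (m%:Z + 2 - x)%R); first by rewrite mem_iota; lia.
  by congr (_, _); lia.
apply/or4P/Or44/mapP; exists (absz (m%:Z + 2 - y)%R); first by rewrite mem_iota; lia.
by congr (_, _); lia.
Qed.

(** Where [w] crosses the border of the block, the inner vertex has a neighbour outside and so lies
    on the ring served by the ladder. The last two hypotheses treat a walk that starts or stops
    inside the block. *)
Lemma block_walk (e : rel site) w :
  subrel e lattice_adj -> sorted e w -> uniq w ->
  (forall u, ohead w = Some u -> block u -> u \in moat_ends) ->
  (forall u q, w = rcons q u -> block u -> u \in moat_ends) ->
  exists q, [/\ path adj (0, 0) q, uniq ((0, 0) :: q), (0 < size q)%N,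
      last (0, 0) q = (m%:Z + 5, m%:Z + 5)
    & forall u v, block u -> block v -> edge ((0, 0) :: q) u v = edge w u v].
Proof.
move=> e_adj w_e w_uniq w_head w_last.
have /andP[] := within_route; rewrite catA all_cat => r_uniq /andP[r_out x_out].
rewrite -catA in r_uniq.
have w_ends : all (ends_in (mem moat_ends)) (runs block w).
  apply: ends_runs => //; apply: sub_sorted w_e => u v /e_adj.
  rewrite /lattice_adj => uv; apply/implyP; case: ifP => bu bv;
    apply: mem_ring_ends; first by [].
  - by move: uv bu bv; rewrite /block; lia.
  - by move: bv; case: (block v).
  by move: uv bu bv; rewrite /block; lia.
rewrite -pmap_moat in w_ends.
have V_uniq : uniq (pmap (@column_end _) moat) by rewrite pmap_moat uniq_moat_ends.
have out : path adj (outer_end (2, 1) moat) exit by rewrite outer_end_moat exit_path.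
have [||||q [q_path q_uniq q_last q_gt0 qE]] := @ladder_walk _ adj block
  (box_adjC _ _) e w (0, 0) [:: (1, 0); (1, 1); (2, 1)] (2, 2) (2, 1) moat exit
  _ w_e w_uniq w_ends V_uniq ladder_moat _ _ isT _ erefl out x_out r_uniq r_out.
- move=> u v bu bv /e_adj uv; rewrite /box_adj uv.
  by move: bu bv; rewrite /block /box; lia.
- by rewrite /box_adj /lattice_adj /box /=; lia.
- by rewrite /block /=; lia.
- by rewrite /box_adj /lattice_adj /box /=; lia.
exists q; split=> //.
by rewrite q_last outer_end_moat last_exit.
Qed.

End Moat.

(** * Crossings as lists of integer sites; [a] and [b] count the vertices on a side, so the L x L
    square has both equal to L + 1 *)

Definition saw (a b : nat) (w : seq site) : bool :=
  if w is u :: r then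
    [&& u == (0, 0), path lattice_adj u r, uniq (u :: r), all (box a b) (u :: r)
      & last u r == (a%:Z - 1, b%:Z - 1)]
  else false.

Lemma square_pos_inj L : injective (@square_pos L).
Proof.
move=> [x y] [x' y'] [xx' yy'].
by congr (_, _); apply: val_inj.
Qed.

Definition walks L : seq (seq site) :=
  [seq map (@square_pos L) w | w : {bseq #|square L| of square L} <-
     enum [set w : {bseq #|square L| of square L} | crossing_saw w]].

Lemma saw_square L (w : seq (square L)) :
  saw L.+1 L.+1 (map (@square_pos L) w) = crossing_saw w.
Proof.
case: w => [//|u r]; rewrite map_cons /saw /crossing_saw path_map.
rewrite -map_cons map_inj_uniq; last exact: square_pos_inj.
have -> : all (box L.+1 L.+1) (map (@square_pos L) (u :: r)).
  by apply/allP=> _ /mapP[[x y] _ ->]; rewrite /box /=;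
    have := ltn_ord x; have := ltn_ord y; lia.
have -> : (0, 0) = @square_pos L (ord0, ord0) by [].
have -> : (L.+1%:Z - 1, L.+1%:Z - 1) = @square_pos L (ord_max, ord_max).
  by congr (_, _) => /=; lia.
by rewrite last_map !(inj_eq (@square_pos_inj L)).
Qed.

Lemma mem_walks L w : (w \in walks L) = saw L.+1 L.+1 w.
Proof.
apply/mapP/idP => [[w']|w_saw].
  by rewrite mem_enum inE => ? ->; rewrite saw_square.
pose g (u : site) : square L := (inord (absz u.1), inord (absz u.2)).
have w_box : all (box L.+1 L.+1) w by case: w w_saw => [//|u r] /and5P[].
have gK : map (@square_pos L) (map g w) = w.
  rewrite -map_comp map_id_in // => -[x y] /(allP w_box).
  rewrite /box /square_pos /= => xy; rewrite !inordK; try lia.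
  by congr (_, _); lia.
have gw : crossing_saw (map g w) by rewrite -saw_square gK.
exists (insubd [bseq] (map g w)).
  by rewrite mem_enum inE insubdK // unfold_in size_crossing_saw.
by rewrite insubdK ?gK // unfold_in size_crossing_saw.
Qed.

Lemma uniq_walks L : uniq (walks L).
Proof.
rewrite map_inj_uniq ?enum_uniq // => w w' /inj_map-/(_ (@square_pos_inj L)).
exact: val_inj.
Qed.

Lemma size_walks L : size (walks L) = crossing_count L.
Proof. by rewrite size_map -cardE. Qed.

Lemma leq_crossing_count L (ws : seq (seq site)) :
  uniq ws -> all (saw L.+1 L.+1) ws -> (size ws <= crossing_count L)%N.
Proof.
move=> ws_uniq /allP ws_saw; rewrite -size_walks; apply: uniq_leq_size => //.
by move=> w /ws_saw; rewrite mem_walks.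
Qed.

Definition many_saws (a b n : nat) :=
  exists ws : seq (seq site), [/\ uniq ws, all (saw a b) ws & size ws = n].

Lemma many_saws_swap a b n : many_saws a b n -> many_saws b a n.
Proof.
move=> [ws [ws_uniq /allP ws_saw <-]].
pose f (u : site) := (u.2, u.1).
have f_inj : injective f by move=> [x y] [x' y'] [-> ->].
exists (map (map f) ws); split; last by rewrite size_map.
  by rewrite map_inj_uniq //; apply: inj_map.
apply/allP=> _ /mapP[w /ws_saw w_saw ->].
case: w w_saw => [//|u r] /and5P[/eqP-> r_path r_uniq r_box /eqP r_last].
apply/and5P; split; first by [].
- rewrite path_map; apply: sub_path r_path => x y /=.
  by rewrite /lattice_adj /=; lia.
- by rewrite -map_cons map_inj_uniq.
- rewrite -map_cons all_map; apply: sub_all r_box => x.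
  by rewrite /box /=; lia.
by rewrite last_map r_last.
Qed.

(** * Chaining crossings along a snake *)

Section Snake.
Variables a b : nat.

(** The first crossing stops at (a - 1, b - 1). The reflected copy leads from (a, b - 1) to (2a - 1,
    0), and the shifted one from (2a, 0) to (3a - 1, b - 1), so consecutive ends are adjacent. *)
Definition flip (u : site) : site := (u.1 + a%:Z, b%:Z - 1 - u.2).
Definition shift (u : site) : site := (u.1 + (2 * a)%:Z, u.2).
Definition snake (w : seq site * (seq site * seq site)) : seq site :=
  w.1 ++ map flip w.2.1 ++ map shift w.2.2.

Lemma flip_inj : injective flip.
Proof. by move=> [x y] [x' y'] [? ?]; congr (_, _); lia. Qed.

Lemma shift_inj : injective shift.
Proof. by move=> [x y] [x' y'] [? ?]; congr (_, _); lia. Qed.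

Definition part (i : nat) (u : site) := (i * a)%:Z <= u.1 < (i.+1 * a)%:Z.

Lemma filter_part i j (s : seq site) : all (part i) s ->
  [seq x <- s | part j x] = if i == j then s else [::].
Proof.
move=> /allP s_part; case: eqP => [<-|ij].
  by apply/all_filterP/allP.
rewrite (eq_in_filter (a2 := pred0)) ?filter_pred0 // => u /s_part.
rewrite /part /= => ui; apply/negbTE/negP => uj.
have [lt_ij|lt_ji|//] := ltngtP i j; nia.
Qed.

Lemma saw_parts w : saw a b w ->
  [/\ all (part 0) w, all (part 1) (map flip w) & all (part 2) (map shift w)].
Proof.
case: w => [//|u r] /and5P[_ _ _ r_box _].
split; rewrite ?all_map; apply: sub_all r_box; clear=> x; rewrite /box /part /=; lia.
Qed.

Lemma saw_snake w : saw a b w.1 -> saw a b w.2.1 -> saw a b w.2.2 ->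
  saw (3 * a) b (snake w).
Proof.
case: w => [w1 [w2 w3]] /= s1 s2 s3.
have [p1 _ _] := saw_parts s1; have [_ p2 _] := saw_parts s2.
have [_ _ p3] := saw_parts s3.
have sep i j (s t : seq site) : i != j -> all (part i) s -> all (part j) t ->
    ~~ has (mem s) t.
  move=> ij si /allP tj; apply/hasPn=> u /tj uj; apply/negP=> us.
  have: u \in [seq x <- s | part j x] by rewrite mem_filter uj.
  by rewrite (filter_part _ si) (negPf ij).
case: w1 s1 p1 => [//|u r] /and5P[/eqP-> r1 u1 b1 /eqP l1] p1.
case: w2 s2 p2 => [//|u2 r2] /and5P[/eqP-> h2 i2 b2 /eqP l2] p2.
case: w3 s3 p3 => [//|u3 r3] /and5P[/eqP-> h3 i3 b3 /eqP l3] p3.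
have fE : path lattice_adj (flip (0, 0)) (map flip r2).
  by rewrite path_map; apply: sub_path h2; clear=> x y; rewrite /lattice_adj /=; lia.
have sE : path lattice_adj (shift (0, 0)) (map shift r3).
  by rewrite path_map; apply: sub_path h3; clear=> x y; rewrite /lattice_adj /=; lia.
apply/and5P; split; first by [].
- rewrite cat_path r1 l1 /= cat_path fE last_map l2 /= sE !andbT.
  by clear; rewrite /lattice_adj /flip /shift /=; lia.
- rewrite -cat_cons !cat_uniq u1 (map_inj_uniq flip_inj) i2.
  rewrite (map_inj_uniq shift_inj) i3 has_cat negb_or.
  by rewrite (sep _ _ _ _ _ p1 p2) // (sep _ _ _ _ _ p1 p3) // (sep _ _ _ _ _ p2 p3).
- rewrite -cat_cons !all_cat !all_map.
  by apply/and3P; split; [apply: sub_all b1|apply: sub_all b2|apply: sub_all b3];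
    clear=> x; rewrite /box /=; lia.
by rewrite !last_cat /= last_map l3 /shift /=; apply/eqP; congr (_, _); clear; lia.
Qed.

(** The three pieces lie in disjoint vertical strips, so filtering the snake by strip recovers
    them. *)
Lemma snake_inj : {in [pred w | [&& saw a b w.1, saw a b w.2.1 & saw a b w.2.2]] &,
  injective snake}.
Proof.
move=> [w1 [w2 w3]] [v1 [v2 v3]]; rewrite !inE /=.
move=> /and3P[/saw_parts[p1 _ _] /saw_parts[_ p2 _] /saw_parts[_ _ p3]].
move=> /and3P[/saw_parts[q1 _ _] /saw_parts[_ q2 _] /saw_parts[_ _ q3]] wv.
have partE j : [seq x <- snake (w1, (w2, w3)) | part j x] =
  [seq x <- snake (v1, (v2, v3)) | part j x] by rewrite wv.
have := partE 0%N; have := partE 1%N; have := partE 2%N.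
rewrite /snake /= !filter_cat !(filter_part _ p1) !(filter_part _ p2).
rewrite !(filter_part _ p3) !(filter_part _ q1) !(filter_part _ q2).
rewrite !(filter_part _ q3) /= !cats0.
by move=> /(inj_map shift_inj)-> /(inj_map flip_inj)-> ->.
Qed.

Lemma many_saws_snake n : many_saws a b n -> many_saws (3 * a) b (n ^ 3).
Proof.
move=> [ws [ws_uniq /allP ws_saw <-]].
pose ts := [seq (x, yz) | x <- ws, yz <- [seq (y, z) | y <- ws, z <- ws]].
have tsP t : t \in ts -> [&& saw a b t.1, saw a b t.2.1 & saw a b t.2.2].
  case/allpairsP=> -[x yz] /= [xw /allpairsP[[y z] /= [yw zw ->]] ->] /=.
  by rewrite !ws_saw.
exists (map snake ts); split.
- rewrite map_inj_in_uniq; last by move=> s t /tsP ? /tsP ?; apply: snake_inj.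
  apply: allpairs_uniq => //; last by move=> [? ?] [? ?] _ _.
  by apply: allpairs_uniq => // -[? ?] [? ?].
- by apply/allP=> _ /mapP[t /tsP/and3P[? ? ?] ->]; apply: saw_snake.
by rewrite size_map !size_allpairs !expnS expn0 muln1.
Qed.

End Snake.

(** The snake triples the width; after exchanging the axes a second snake triples the other side,
    and the count becomes (n^3)^3. *)
Lemma crossing_count_triple L :
  (crossing_count L ^ 9 <= crossing_count (3 * L.+1).-1)%N.
Proof.
have: many_saws L.+1 L.+1 (crossing_count L).
  exists (walks L); split; [exact: uniq_walks|by apply/allP=> w; rewrite mem_walks|].
  exact: size_walks.
move=> /many_saws_snake/many_saws_swap/many_saws_snake[ws [ws_uniq ws_saw ws_size]].
by rewrite (expnM _ 3 3) -ws_size leq_crossing_count // prednK.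
Qed.

Lemma crossing_count1 : (1 < crossing_count 1)%N.
Proof.
by apply: (@leq_crossing_count 1
  [:: [:: (0, 0); (0, 1); (1, 1)]; [:: (0, 0); (1, 0); (1, 1)]]).
Qed.

(** * Encoding a crossing by its traces in blocks and the edges between blocks *)

Section Blocks.
Variables m k : nat.
Hypotheses (m_gt1 : (1 < m)%N) (k_gt0 : (0 < k)%N).

Notation N := (k * m)%N.

Definition trace (x0 y0 : nat) (w : seq site) :
    {set ('I_m * 'I_m) * ('I_m * 'I_m)} :=
  [set z : ('I_m * 'I_m) * ('I_m * 'I_m) |
    edge w ((x0 + z.1.1)%N%:Z, (y0 + z.1.2)%N%:Z)
           ((x0 + z.2.1)%N%:Z, (y0 + z.2.2)%N%:Z)].

Definition block_traces : {set {set ('I_m * 'I_m) * ('I_m * 'I_m)}} :=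
  [set D in [seq trace 3 3 w | w <- walks (m + 5)]].

Lemma card_block_traces : (#|block_traces| <= crossing_count (m + 5))%N.
Proof.
rewrite -size_walks -(size_map (trace 3 3)) cardsE; exact: card_size.
Qed.

(** Translating block (i, j) to lower left corner (3, 3) makes it the block inside the moat, where
    [block_walk] supplies one crossing with the same trace. *)
Lemma trace_in (i j : 'I_k) w : saw N N w ->
  trace (i * m) (j * m) w \in block_traces.
Proof.
case: w => [//|u r] /and5P[/eqP-> r_path r_uniq r_box /eqP r_last].
pose f (u : site) : site := (u.1 - (i * m)%N%:Z + 3, u.2 - (j * m)%N%:Z + 3).
have f_inj : injective f.
  by clear=> -[x y] [x' y'] []; rewrite /= => ? ?; congr (_, _); lia.
have [] := @block_walk m m_gt1 lattice_adj (map f ((0, 0) :: r)).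
- by [].
- rewrite map_cons /= path_map; apply: sub_path r_path; clear=> x y.
  by rewrite /lattice_adj /=; lia.
- by rewrite map_inj_uniq.
(* Both ends of the walk are corners of the large square, hence on the border of any block that
   contains them. *)
- move=> _ [<-]; rewrite /block /f /= => bu; apply: mem_ring_ends => //=.
  by clear -bu m_gt1; nia.
- move=> v q qE; have: last (f (0, 0)) (map f r) = v.
    by have := congr1 (last (f (0, 0))) qE; rewrite last_rcons.
  rewrite last_map r_last => <-; rewrite /block /f /= => bu.
  apply: mem_ring_ends => //=.
  by have := ltn_ord i; have := ltn_ord j; clear -bu m_gt1 k_gt0; nia.
move=> q [q_path q_uniq q_gt0 q_last qE].
rewrite inE; apply/mapP; exists ((0, 0) :: q).
  rewrite mem_walks; apply/and5P; split=> //.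
  - by apply: sub_path q_path => x y /and3P[].
  - rewrite -addnS; apply/allP=> x; rewrite inE => /orP[/eqP->|].
      by rewrite /box /=; clear; lia.
    elim: q (0, 0) q_path {q_uniq q_gt0 q_last qE} => [//|y q IHq] z /=.
    move=> /andP[/and3P[_ _ y_box] y_path]; rewrite inE => /orP[/eqP->//|].
    exact: IHq y_path.
  - by rewrite q_last; apply/eqP; congr (_, _); clear; lia.
apply/setP=> -[[x y] [x' y']]; rewrite !inE /=.
rewrite qE; last 2 first.
- by have := ltn_ord x; have := ltn_ord y; rewrite /block /=; clear; lia.
- by have := ltn_ord x'; have := ltn_ord y'; rewrite /block /=; clear; lia.
rewrite -(edge_map _ _ _ f_inj); congr (edge _ (_, _) (_, _)) => /=; clear; lia.
Qed.

Definition across_x (w : seq site) : {set 'I_k * 'I_N} :=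
  [set z : 'I_k * 'I_N | edge w ((z.1 * m + m.-1)%N%:Z, (z.2 : nat)%:Z)
                               ((z.1 * m + m)%N%:Z, (z.2 : nat)%:Z)].

Definition across_y (w : seq site) : {set 'I_k * 'I_N} :=
  [set z : 'I_k * 'I_N | edge w ((z.2 : nat)%:Z, (z.1 * m + m.-1)%N%:Z)
                               ((z.2 : nat)%:Z, (z.1 * m + m)%N%:Z)].

Definition code (w : seq site) :=
  ([ffun ij : 'I_k * 'I_k => trace (ij.1 * m) (ij.2 * m) w],
   (across_x w, across_y w)).

Lemma step_split x : exists (i : nat) (c : nat), [/\ x = (i * m + c)%N, (c < m)%N &
  (c.+1 < m)%N \/ c = m.-1].
Proof.
exists (x %/ m)%N, (x %% m)%N; rewrite -divn_eq ltn_mod.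
by have := ltn_pmod x (ltnW m_gt1); split => //; lia.
Qed.

(** A unit step either stays in a block and is seen by its trace, or leaves the last row or column
    of a block and is seen by [across_x] or [across_y]. The two equations treat horizontal and
    vertical steps at once. *)
Lemma code_step w w' (x y : nat) : code w = code w' ->
  (x.+1 < N)%N -> (y < N)%N ->
  edge w (x%:Z, y%:Z) (x.+1%:Z, y%:Z) = edge w' (x%:Z, y%:Z) (x.+1%:Z, y%:Z) /\
  edge w (y%:Z, x%:Z) (y%:Z, x.+1%:Z) = edge w' (y%:Z, x%:Z) (y%:Z, x.+1%:Z).
Proof.
case=> /ffunP traceE /setP acrossxE /setP acrossyE xN yN.
have [i [c [xE c_lt c_last]]] := step_split x.
have [j [d [yE d_lt _]]] := step_split y.
have ik : (i < k)%N by clear -xN xE; nia.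
have jk : (j < k)%N by clear -yN yE; nia.
case: c_last => [c1_lt|cE].
  have := traceE (Ordinal ik, Ordinal jk).
  have := traceE (Ordinal jk, Ordinal ik).
  rewrite !ffunE /= => /setP t1 /setP t2.
  have := t2 ((Ordinal c_lt, Ordinal d_lt), (Ordinal c1_lt, Ordinal d_lt)).
  have := t1 ((Ordinal d_lt, Ordinal c_lt), (Ordinal d_lt, Ordinal c1_lt)).
  by rewrite !inE /= addnS -xE -yE => -> ->.
have xS : (x.+1 = i * m + m)%N by rewrite xE cE; lia.
have := acrossxE (Ordinal ik, Ordinal yN); have := acrossyE (Ordinal ik, Ordinal yN).
by rewrite !inE /= -xS -cE -xE => -> ->.
Qed.

Lemma code_edge w w' u v : saw N N w -> code w = code w' ->
  edge w u v -> edge w' u v.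
Proof.
case: w => [//|u0 r] /and5P[_ r_path _ /allP r_box _] ww' uv.
have u_adj : lattice_adj u v.
  by apply: (@edge_sorted _ _ (u0 :: r)) uv => //; apply: lattice_adjC.
have /andP[/r_box ub /r_box vb] := edge_mem uv.
case: u v uv u_adj ub vb => [x y] [x' y']; rewrite /box /lattice_adj /=.
case: x => x; last by move=> _ _; clear; lia.
case: y => y; last by move=> _ _; clear; lia.
case: x' => x'; last by move=> _ _ _; clear; lia.
case: y' => y'; last by move=> _ _ _; clear; lia.
move=> uv u_adj ub vb.
have : [\/ x' = x.+1 /\ y = y', x = x'.+1 /\ y = y', y' = y.+1 /\ x = x'
    | y = y'.+1 /\ x = x'].
  have : [|| (x' == x.+1) && (y == y'), (x == x'.+1) && (y == y'),
    (y' == y.+1) && (x == x') | (y == y'.+1) && (x == x')].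
    by clear -u_adj; lia.
  by case/or4P=> /andP[/eqP-> /eqP->]; [apply: Or41|apply: Or42|apply: Or43|apply: Or44].
case=> -[e1 e2]; subst.
- by have [<- _] := @code_step _ _ x y' ww' ltac:(clear -vb; lia) ltac:(clear -vb; lia).
- rewrite edge_sym in uv; rewrite edge_sym.
  by have [<- _] := @code_step _ _ x' y' ww' ltac:(clear -ub; lia) ltac:(clear -ub; lia).
- by have [_ <-] := @code_step _ _ y x' ww' ltac:(clear -vb; lia) ltac:(clear -vb; lia).
- rewrite edge_sym in uv; rewrite edge_sym.
  by have [_ <-] := @code_step _ _ y' x' ww' ltac:(clear -ub; lia) ltac:(clear -ub; lia).
Qed.

Lemma code_inj : {in saw N N &, injective code}.
Proof.
move=> w w'; rewrite ![_ \in _]unfold_in => w_saw w'_saw ww'.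
have edgeE : edge w =2 edge w'.
  move=> u v; apply/idP/idP; first exact: code_edge.
  exact: code_edge.
case: w w_saw edgeE {ww'} => [//|u r] /and5P[/eqP-> _ r_uniq _ _].
case: w' w'_saw => [//|u' r'] /and5P[/eqP-> _ r'_uniq _ _] edgeE.
by rewrite (edge_inj r_uniq r'_uniq edgeE).
Qed.

(** Counts the possible codes: k^2 traces, and two sets of crossing edges, each a subset of a set of
    size k N. *)
Lemma crossing_count_blocks :
  (crossing_count N.-1 <=
     crossing_count (m + 5) ^ (k * k) * (2 ^ (k * N) * 2 ^ (k * N)))%N.
Proof.
have N_gt0 : (0 < N)%N by rewrite muln_gt0 k_gt0 ltnW.
have codeP w : w \in walks N.-1 -> saw N N w by rewrite mem_walks prednK.
rewrite -size_walks -(size_map code).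
have codes_uniq : uniq (map code (walks N.-1)).
  rewrite map_inj_in_uniq ?uniq_walks // => w w' /codeP w_saw /codeP w'_saw.
  exact: code_inj.
pose T := finset.setX [set f : {ffun 'I_k * 'I_k -> _} | f \in ffun_on (mem block_traces)]
  (finset.setX [set: {set 'I_k * 'I_N}] [set: {set 'I_k * 'I_N}]).
apply: (@leq_trans #|T|).
  rewrite -(card_uniqP codes_uniq); apply: subset_leq_card.
  apply/fintype.subsetP=> _ /mapP[w /codeP w_saw ->].
  rewrite /T /code !finset.in_setX !finset.in_setT finset.in_set !andbT.
  by apply/ffun_onP=> -[i j]; rewrite ffunE trace_in.
rewrite !cardsX cardsE card_ffun_on -!powersetT !card_powerset !cardsT.
rewrite !card_prod !card_ord leq_mul2r; apply/orP; right.
by rewrite leq_exp2r ?muln_gt0 ?k_gt0 // card_block_traces.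
Qed.

End Blocks.

(** * Logarithmic bounds by passage to the limit *)

Local Open Scope classical_set_scope.
Local Open Scope ring_scope.

Section Limit.
Variables (R : realType) (lambda : R).
Hypothesis lambdaE : (fun L : nat => ln ((crossing_count L)%:R : R) / L%:R ^+ 2)
                 @ \oo --> ln lambda.

Let f (L : nat) : R := ln ((crossing_count L)%:R : R) / L%:R ^+ 2.

Lemma le_ln_lambda (c : R) :
  (forall n0, exists2 n, (n0 <= n)%N & c <= f n) -> c <= ln lambda.
Proof.
move=> cP; apply/ler_addgt0Pr => eps eps_gt0.
have [n0 _ n0P] := (cvgrPdist_le _ _).1 lambdaE eps eps_gt0.
have [n n0n cf] := cP n0.
have := n0P n n0n; rewrite /= -/(f n) => h.
by move: h; rewrite ler_norml => /andP[h _]; lra.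
Qed.

Lemma ge_ln_lambda (c : R) :
  (forall n0, exists2 n, (n0 <= n)%N & f n <= c) -> ln lambda <= c.
Proof.
move=> cP; apply/ler_addgt0Pr => eps eps_gt0.
have [n0 _ n0P] := (cvgrPdist_le _ _).1 lambdaE eps eps_gt0.
have [n n0n cf] := cP n0.
have := n0P n n0n; rewrite /= -/(f n) => h.
by move: h; rewrite ler_norml => /andP[_ h]; lra.
Qed.

Lemma ln_nat_ge0 n : 0 <= ln (n%:R : R).
Proof. by case: n => [|n]; [rewrite ln0|rewrite ln_ge0 // ler1n]. Qed.

Lemma ler_ln_nat n p : (n <= p)%N -> ln (n%:R : R) <= ln (p%:R : R).
Proof.
case: n => [|n] np; first by rewrite ln0 // ln_nat_ge0.
by rewrite ler_ln ?posrE ?ltr0n ?ler_nat // (leq_trans _ np).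
Qed.

Lemma ln_natX n p : ln ((n ^ p)%N%:R : R) = ln (n%:R : R) *+ p.
Proof.
case: n => [|n]; last by rewrite natrX lnXn ?ltr0n.
case: p => [|p]; first by rewrite expn0 ln1 mulr0n.
by rewrite exp0n // ln0 // mul0rn.
Qed.

Lemma crossing_count_pow L i :
  (crossing_count L ^ (9 ^ i) <= crossing_count (3 ^ i * L.+1).-1)%N.
Proof.
elim: i => [|i IHi]; first by rewrite !expn0 expn1 mul1n.
rewrite expnSr expnM; apply: leq_trans (_ : crossing_count (3 ^ i * L.+1).-1 ^ 9 <= _)%N.
  by rewrite leq_exp2r.
apply: leq_trans (crossing_count_triple _) _.
by rewrite prednK ?muln_gt0 ?expn_gt0 // mulnA -expnS.
Qed.

(** For n = 3^i (L + 1) - 1 the iterated snake gives log C(n) >= 9^i log C(L), while n^2 <= 9^i (L +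
    1)^2. So log C(n) / n^2 is at least log C(L) / (L + 1)^2 along a subsequence. *)
Lemma ln_crossing_count_le L :
  ln ((crossing_count L)%:R : R) <= L.+1%:R ^+ 2 * ln lambda.
Proof.
rewrite mulrC -ler_pdivrMr ?exprn_gt0 ?ltr0n //; apply: le_ln_lambda => n0.
exists (3 ^ n0.+1 * L.+1).-1.
  have := ltn_expl n0.+1 (isT : (1 < 3)%N).
  by move: (3 ^ n0.+1)%N => q; nia.
rewrite /f; set n := (_ * _).-1.
have n_gt0 : (0 < n)%N.
  by rewrite /n; have := ltn_expl n0.+1 (isT : (1 < 3)%N); move: (3 ^ n0.+1)%N => q; nia.
have /ler_ln_nat := crossing_count_pow L n0.+1; rewrite -/n ln_natX => h.
rewrite ler_pdivlMr ?exprn_gt0 ?ltr0n //; apply: le_trans h.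
rewrite mulrAC ler_pdivrMr ?exprn_gt0 ?ltr0n // -[ln _ *+ _]mulr_natr -mulrA.
apply: ler_wpM2l; first exact: ln_nat_ge0.
rewrite -!natrX -natrM ler_nat -[9%N]/(3 ^ 2)%N expnAC -expnMn.
by rewrite leq_exp2r // /n leq_pred.
Qed.

Lemma ln_lambda_gt0 : 0 < ln lambda.
Proof.
have := ln_crossing_count_le 1; have : 0 < ln ((crossing_count 1)%:R : R).
  by rewrite ln_gt0 // ltr1n crossing_count1.
by move=> h1 h2; have := lt_le_trans h1 h2; rewrite pmulr_rgt0 // exprn_gt0.
Qed.

(** For n = km - 1 the block code gives log C(n) <= k^2 (log C(m + 5) + 2 m log 2), and n >= k (m -
    1); divide by n^2 and let k grow. *)
Lemma ln_crossing_count_ge m : (1 < m)%N ->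
  m.-1%:R ^+ 2 * ln lambda <=
    ln ((crossing_count (m + 5))%:R : R) + m%:R * (2 * ln (2 : R)).
Proof.
move=> m_gt1; have m1_gt0 : (0 < m.-1)%N by lia.
rewrite mulrC -ler_pdivlMr ?exprn_gt0 ?ltr0n //; apply: ge_ln_lambda => n0.
exists (n0.+1 * m).-1; first by nia.
set k := n0.+1; rewrite /f; set n := (k * m).-1.
have n_gt0 : (0 < n)%N by rewrite /n /k; nia.
have /ler_ln_nat := crossing_count_blocks m_gt1 (isT : (0 < k)%N).
rewrite -/n -expnD addnn => h.
rewrite ler_pdivrMr ?exprn_gt0 ?ltr0n // mulrAC ler_pdivlMr ?exprn_gt0 ?ltr0n //.
have pow2_gt0 : (0 < 2 ^ (k * (k * m)).*2)%N by rewrite expn_gt0.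
have {}h : ln ((crossing_count n)%:R : R) <=
    k%:R ^+ 2 * (ln ((crossing_count (m + 5))%:R : R) + m%:R * (2 * ln (2 : R))).
  have pow2E : ln ((2 ^ (k * (k * m)).*2)%N%:R : R) =
      k%:R ^+ 2 * (m%:R * (2 * ln (2 : R))).
    by rewrite ln_natX -[ln _ *+ _]mulr_natr -addnn natrD !natrM; ring.
  apply: le_trans h _.
  (* For a zero count the product is 0 and [ln 0 = 0], so it suffices that the right side is
     nonnegative; otherwise [lnM] splits the product. *)
  have [->|c_gt0] := posnP (crossing_count (m + 5)).
    rewrite exp0n ?muln_gt0 // mul0n ln0 // mulrDr -pow2E.
    by rewrite addr_ge0 ?mulr_ge0 ?sqr_ge0 ?ln_nat_ge0.
  rewrite mulrDr natrM lnM ?posrE ?ltr0n ?expn_gt0 ?c_gt0 //.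
  rewrite pow2E ln_natX -[ln _ *+ _]mulr_natr natrM.
  by rewrite lerD2r mulrC expr2.
apply: le_trans (ler_wpM2r (sqr_ge0 _) h) _.
rewrite mulrAC mulrC; apply: ler_wpM2l.
  apply: addr_ge0; first exact: ln_nat_ge0.
  by rewrite mulr_ge0 ?ler0n // mulr_ge0 // ln_ge0 // ler1n.
rewrite -!natrX -natrM ler_nat -expnMn leq_exp2r //.
by rewrite /n /k; nia.
Qed.

End Limit.

Theorem theorem1 (R : realType) (lambda : R) (lambda_gt0 : 0 < lambda)
    (lambdaE : (fun L : nat => ln ((crossing_count L)%:R : R) / L%:R ^+ 2)
                 @ \oo --> ln lambda) :
  exists (r : nat -> R) (K : R),
    (forall L : nat, (0 < L)%N ->
       ln ((crossing_count L)%:R : R) = (L%:R ^+ 2 + r L) * ln lambda) /\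
    (\forall L \near \oo, `|r L| <= K * L%:R).
Proof.
have log_gt0 := ln_lambda_gt0 lambdaE.
pose c := 2 * ln (2 : R) / ln lambda.
(* [r] is obtained by solving the required equation. The bounds will read r <= (L + 1)^2 - L^2 and r
   >= (L - 6)^2 - L^2 - c (L - 5); the cross term 12 L of the latter explains the constant. *)
exists (fun L => ln ((crossing_count L)%:R : R) / ln lambda - L%:R ^+ 2), (12 + c).
split=> [L _|].
  by rewrite addrC subrK divfK // gt_eqF.
(* The lower bound is applied with m = L - 5, which must be at least 2; writing m as [(L - 7).+2]
   makes this hold by computation. *)
exists 7%N => // L /= L_ge7.
have c_ge0 : 0 <= c.
  by rewrite /c divr_ge0 ?(ltW log_gt0) // mulr_ge0 // ln_ge0 // ler1n.
have L_gt0 : 7 <= L%:R :> R by rewrite ler_nat.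
have upper := ln_crossing_count_le lambdaE L.
have lower := ln_crossing_count_ge lambdaE (isT : (1 < (L - 7).+2)%N).
have L5 : ((L - 7).+2 + 5)%N = L by lia.
have m_eq : ((L - 7).+2)%:R = L%:R - 5 :> R.
  by rewrite -[in RHS]L5 natrD addrK.
have m1_eq : ((L - 7).+2.-1)%:R = L%:R - 6 :> R.
  have -> : ((L - 7).+2.-1 = L - 6)%N by lia.
  by rewrite natrB //; lia.
rewrite L5 m_eq m1_eq in lower.
have cE : 2 * ln (2 : R) = c * ln lambda by rewrite divfK // gt_eqF.
set x := _ / ln lambda.
have xE : ln ((crossing_count L)%:R : R) = x * ln lambda by rewrite divfK // gt_eqF.
rewrite xE ler_pM2r // in upper.
rewrite xE cE mulrA -mulrDl ler_pM2r // in lower.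
rewrite -natr1 in upper.
rewrite ler_norml; apply/andP; split; nra.
Qed.
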